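(* For all non-zero integers $m$ and $n$, there exists a non-trivial element $\gamma$ of the Baumslag–Solitar group $BS(m,n)=\langle a,b\mid ab^ma^{-1}=b^n\rangle$ such that $\gamma$ fixes an unbounded subtree of the Bass–Serre tree associated with $BS(m,n)$.
   Context: Write $\Gamma=BS(m,n)$, $\Lambda=\langle b\rangle\cong\mathbb{Z}$, $H=\langle b^n\rangle$, $K=\langle b^m\rangle$. Then $\Gamma$ is the HNN extension $\langle\Lambda,t\mid t^{-1}ht=\phi(h)\ \forall h\in H\rangle$ with $t=a$ and $\phi:H\to K$, $\phi(b^{nk})=b^{mk}$. The associated Bass–Serre tree has vertex set $\Gamma/\Lambda$ and set of positively oriented edges $\Gamma/H$, where the edge $\gamma H$ has origin $\gamma\Lambda$ and terminal vertex $\gamma a\Lambda$; $\Gamma$ acts on it by left multiplication. Boundedness is with respect to the path metric on the tree. *)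

(* Defs.v *)
From HB Require Import structures.
From mathcomp Require Import all_boot all_order all_algebra.
From mathcomp Require Import zify.
From mathcomp Require Import boolp classical_sets.

Set Implicit Arguments.
Unset Strict Implicit.
Unset Printing Implicit Defensive.

Local Open Scope group_scope.
Local Open Scope quotient_scope.

(* The letter (x, false) stands for x and the letter (x, true) for x^-1. *)
Definition word (X : choiceType) : choiceType := seq (X * bool).

Section Presentation.
Variables (X : choiceType) (R : word X -> word X -> Prop).

Inductive word_eq : word X -> word X -> Prop :=
| WeqRefl u : word_eq u u
| WeqSym u v : word_eq u v -> word_eq v u
| WeqTrans u v w : word_eq u v -> word_eq v w -> word_eq u w
| WeqCat u u' v v' : word_eq u u' -> word_eq v v' -> word_eq (u ++ v) (u' ++ v')
| WeqCancel x e : word_eq [:: (x, e); (x, ~~ e)] [::]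
| WeqRel u v : R u v -> word_eq u v.

Definition word_eqb (u v : word X) : bool := `[< word_eq u v >].

Lemma word_eqb_refl : reflexive word_eqb.
Proof. by move=> u; apply/asboolP; exact: WeqRefl. Qed.

Lemma word_eqb_sym : symmetric word_eqb.
Proof. by move=> u v; apply/asboolP/asboolP; exact: WeqSym. Qed.

Lemma word_eqb_trans : transitive word_eqb.
Proof.
by move=> v u w /asboolP uv /asboolP vw; apply/asboolP; exact: WeqTrans uv vw.
Qed.

Canonical word_eqb_equiv :=
  EquivRel word_eqb word_eqb_refl word_eqb_sym word_eqb_trans.

Definition presented := {eq_quot word_eqb}.
HB.instance Definition _ := Choice.copy presented {eq_quot word_eqb}.

Definition pword (u : word X) : presented := \pi_{eq_quot word_eqb} u.

Lemma pwordP (u v : word X) : pword u = pword v <-> word_eq u v.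
Proof.
split=> [/eqmodP/asboolP //|uv]; apply/eqmodP; exact/asboolP.
Qed.

Definition invw (u : word X) : word X := rev [seq (s.1, ~~ s.2) | s <- u].

Lemma invw_cat u v : invw (u ++ v) = invw v ++ invw u.
Proof. by rewrite /invw map_cat rev_cat. Qed.

Lemma invwK : involutive invw.
Proof.
move=> u; rewrite /invw map_rev revK -map_comp -[RHS]map_id.
by apply: eq_map => -[x e] /=; rewrite negbK.
Qed.

Lemma mul_invw u : word_eq (u ++ invw u) [::].
Proof.
elim: u => [|[x e] u IHu]; first exact: WeqRefl.
rewrite -cat1s invw_cat -catA [u ++ _]catA.
apply: WeqTrans (WeqCancel x e).
rewrite -[[:: _; _]]/([:: (x, e)] ++ [::] ++ [:: (x, ~~ e)]).
by apply: WeqCat; [exact: WeqRefl | apply: WeqCat => //; exact: WeqRefl].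
Qed.

Lemma mulw_inv u : word_eq (invw u ++ u) [::].
Proof. by rewrite -{2}[u]invwK; exact: mul_invw. Qed.

Lemma invw_eq u v : word_eq u v -> word_eq (invw u) (invw v).
Proof.
move=> uv; rewrite -[invw u]cats0.
apply: (@WeqTrans _ (invw u ++ v ++ invw v)).
  by apply: WeqCat; [exact: WeqRefl | apply/WeqSym/mul_invw].
rewrite catA -[X in word_eq _ X]cat0s; apply: WeqCat; last exact: WeqRefl.
apply: WeqTrans (mulw_inv u).
by apply: WeqCat; [exact: WeqRefl | exact: WeqSym].
Qed.

Definition pone : presented := pword [::].
Definition pmul (g h : presented) : presented := pword (repr g ++ repr h).
Definition pinv (g : presented) : presented := pword (invw (repr g)).

Lemma repr_pword u : word_eq (repr (pword u)) u.
Proof. by apply/pwordP; rewrite /pword reprK. Qed.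

Lemma pwordM u v : pmul (pword u) (pword v) = pword (u ++ v).
Proof. by apply/pwordP/WeqCat; exact: repr_pword. Qed.

Lemma pwordV u : pinv (pword u) = pword (invw u).
Proof. by apply/pwordP/invw_eq/repr_pword. Qed.

Lemma pword_surj (g : presented) : g = pword (repr g).
Proof. by rewrite /pword reprK. Qed.

Lemma pmulA : associative pmul.
Proof.
move=> x y z; rewrite (pword_surj x) (pword_surj y) (pword_surj z).
by rewrite !pwordM catA.
Qed.

Lemma pmul1g : left_id pone pmul.
Proof. by move=> x; rewrite (pword_surj x) pwordM. Qed.

Lemma pmulg1 : right_id pone pmul.
Proof. by move=> x; rewrite (pword_surj x) pwordM cats0. Qed.

Lemma pmulVg : left_inverse pone pinv pmul.
Proof.
by move=> x; rewrite (pword_surj x) pwordV pwordM; apply/pwordP/mulw_inv.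
Qed.

Lemma pmulgV : right_inverse pone pinv pmul.
Proof.
by move=> x; rewrite (pword_surj x) pwordV pwordM; apply/pwordP/mul_invw.
Qed.

HB.instance Definition _ :=
  isGroup.Build presented pmulA pmul1g pmulg1 pmulVg pmulgV.

End Presentation.

Definition expz (G : groupType) (x : G) (k : int) : G :=
  match k with Posz j => x ^+ j | Negz j => x ^- j.+1 end.

Section Cosets.
Variables (G : groupType) (x : G).

Lemma expzN k : expz x (- k)%R = (expz x k)^-1.
Proof. by case: k => [[|k]|k] /=; rewrite ?invg1 ?invgK. Qed.

Lemma expzS k : expz x (k + 1)%R = expz x k * x.
Proof.
case: k => [k|[|k]]; first by rewrite /= addn1 expgSr.
  by rewrite /= expg1 mulVg.
have -> : (Negz k.+1 + 1 = Negz k)%R by lia.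
by rewrite /= [x ^+ k.+2]expgS invgM mulgVK.
Qed.

Lemma expzD k l : expz x (k + l)%R = expz x k * expz x l.
Proof.
elim/int_ind: l => [|l IHl|l IHl]; first by rewrite GRing.addr0 /= mulg1.
  by rewrite -[l.+1]addn1 PoszD GRing.addrA !expzS IHl mulgA.
apply: (mulIg x); rewrite -mulgA -!expzS -GRing.addrA.
by have -> : (- l.+1%:Z + 1 = - l%:Z)%R by lia.
Qed.

(* g and h lie in the same left coset of <x>. *)
Definition lcoset_rel (g h : G) : bool :=
  `[< exists k : int, h = g * expz x k >].

Lemma lcoset_rel_refl : reflexive lcoset_rel.
Proof. by move=> g; apply/asboolP; exists 0%R; rewrite /= mulg1. Qed.

Lemma lcoset_rel_sym : symmetric lcoset_rel.
Proof.
suff sub g h : lcoset_rel g h -> lcoset_rel h g.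
  by move=> g h; apply/idP/idP; exact: sub.
by move=> /asboolP[k ->]; apply/asboolP; exists (- k)%R; rewrite expzN mulgK.
Qed.

Lemma lcoset_rel_trans : transitive lcoset_rel.
Proof.
move=> h g i /asboolP[k ->] /asboolP[l ->]; apply/asboolP.
by exists (k + l)%R; rewrite expzD mulgA.
Qed.

Canonical lcoset_rel_equiv :=
  EquivRel lcoset_rel lcoset_rel_refl lcoset_rel_sym lcoset_rel_trans.

Definition lcosets := {eq_quot lcoset_rel}.
HB.instance Definition _ := Choice.copy lcosets {eq_quot lcoset_rel}.

Definition lcoset (g : G) : lcosets := \pi_{eq_quot lcoset_rel} g.

Lemma lcosetP (g h : G) : lcoset g = lcoset h <-> exists k, h = g * expz x k.
Proof. by split=> [/eqmodP/asboolP //|gh]; apply/eqmodP; exact/asboolP. Qed.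

Lemma repr_lcoset g : exists k, repr (lcoset g) = g * expz x k.
Proof. by apply/lcosetP; rewrite /lcoset reprK. Qed.

Definition lcoset_act (g : G) (c : lcosets) : lcosets := lcoset (g * repr c).

Lemma lcoset_actE g h : lcoset_act g (lcoset h) = lcoset (g * h).
Proof.
have [k hk] := repr_lcoset h.
by apply/esym/lcosetP; exists k; rewrite hk mulgA.
Qed.

End Cosets.

Lemma expzM (G : groupType) (x : G) k l : expz (expz x k) l = expz x (k * l)%R.
Proof.
elim/int_ind: l => [|l IHl|l IHl]; first by rewrite GRing.mulr0.
  by rewrite -[l.+1]addn1 PoszD expzS IHl GRing.mulrDr GRing.mulr1 expzD.
apply: (mulIg (expz x k)); rewrite -expzS -expzD.
have -> : (- l.+1%:Z + 1 = - l%:Z)%R by lia.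
by rewrite IHl; congr expz; lia.
Qed.

Lemma expz_conj (G : groupType) (x y : G) k :
  expz (y * x * y^-1) k = y * expz x k * y^-1.
Proof.
elim/int_ind: k => [|k IHk|k IHk]; first by rewrite /= mulg1 mulgV.
  by rewrite -[k.+1]addn1 PoszD !expzS IHk !mulgA mulgVK.
apply: (mulIg (y * x * y^-1)); rewrite -expzS.
have e : (- k.+1%:Z + 1 = - k%:Z)%R by lia.
by rewrite e IHk -e expzS !mulgA mulgVK.
Qed.

Record graph := Graph {
  vert : eqType;
  edge : eqType;
  origin : edge -> vert;
  terminus : edge -> vert }.

Section Graphs.
Variable X : graph.

(* The dart (e, false) is e traversed from its origin to its terminus, and
   (e, true) is e traversed backwards. *)
Definition dart : eqType := (edge X * bool)%type.
Definition dsrc (s : dart) := if s.2 then terminus s.1 else origin s.1.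
Definition dtgt (s : dart) := if s.2 then origin s.1 else terminus s.1.
Definition drev (s : dart) : dart := (s.1, ~~ s.2).

Fixpoint walk (u : vert X) (p : seq dart) (v : vert X) : bool :=
  if p is s :: p' then (dsrc s == u) && walk (dtgt s) p' v else u == v.

Definition no_backtrack (p : seq dart) : bool :=
  sorted (fun s s' => s' != drev s) p.

(* Circuits in the sense of Serre; loops and pairs of parallel edges count. *)
Definition circuit (p : seq dart) : Prop :=
  [/\ p != [::], exists u, walk u p u, no_backtrack p & uniq (map dtgt p)].

Record subgraph := Subgraph {
  sverts : set (vert X);
  sedges : set (edge X);
  sub_origin : forall e, sedges e -> sverts (origin e);
  sub_terminus : forall e, sedges e -> sverts (terminus e) }.

Definition walk_in (T : subgraph) (p : seq dart) : Prop :=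
  forall s, s \in p -> sedges T s.1.

(* The last clause is the acyclicity of T itself, so that T is a tree whether or
   not X is known to be one. *)
Definition is_subtree (T : subgraph) : Prop :=
  [/\ exists u, sverts T u,
      forall u v, sverts T u -> sverts T v ->
        exists2 p, walk u p v & walk_in T p
    & forall p, circuit p -> ~ walk_in T p].

Definition is_dist (u v : vert X) (d : nat) : Prop :=
  (exists2 p, walk u p v & size p = d) /\
  (forall p, walk u p v -> (d <= size p)%N).

Definition bounded_verts (A : set (vert X)) : Prop :=
  exists N : nat, forall u v d, A u -> A v -> is_dist u v d -> (d <= N)%N.

End Graphs.

Definition gen_a : bool := false.
Definition gen_b : bool := true.

Definition word_a : word bool := [:: (gen_a, false)].
Definition word_aV : word bool := [:: (gen_a, true)].
Definition word_b : word bool := [:: (gen_b, false)].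
Definition word_bz (k : int) : word bool :=
  match k with
  | Posz j => nseq j (gen_b, false)
  | Negz j => nseq j.+1 (gen_b, true)
  end.

Definition BS_rel (m n : int) (u v : word bool) : Prop :=
  u = word_a ++ word_bz m ++ word_aV /\ v = word_bz n.

Definition BS (m n : int) : groupType := presented (BS_rel m n).

Section BassSerre.
Variables m n : int.

Definition bs_a : BS m n := pword (BS_rel m n) word_a.
Definition bs_b : BS m n := pword (BS_rel m n) word_b.

Lemma pword_bz (k : int) : pword (BS_rel m n) (word_bz k) = expz bs_b k.
Proof.
have pos j : pword (BS_rel m n) (nseq j (gen_b, false)) = bs_b ^+ j.
  by elim: j => [//|j IHj]; rewrite expgS -IHj; exact/esym/pwordM.
case: k => [k|k] /=; first exact: pos.
rewrite -pos; have -> : (gen_b, true) :: nseq k (gen_b, true)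
    = invw (nseq k.+1 (gen_b, false)) :> word bool.
  by rewrite /invw map_nseq rev_nseq.
exact/esym/pwordV.
Qed.

Lemma BS_relation : bs_a * expz bs_b m * bs_a^-1 = expz bs_b n.
Proof.
have aV : bs_a^-1 = pword (BS_rel m n) word_aV by exact: pwordV.
have M u v : pword (BS_rel m n) u * pword _ v = pword _ (u ++ v).
  exact: pwordM.
rewrite aV -!pword_bz (M word_a (word_bz m)) (M (word_a ++ word_bz m)) -catA.
by apply/pwordP/WeqRel.
Qed.

(* The edge g <b^n> goes from g <b> to g a <b>; bst_originE and bst_terminusE
   show that this does not depend on the representative g. *)
Definition bst_vert := lcosets bs_b.
Definition bst_edge := lcosets (expz bs_b n).
Definition bst_origin (e : bst_edge) : bst_vert := lcoset bs_b (repr e).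
Definition bst_terminus (e : bst_edge) : bst_vert :=
  lcoset bs_b (repr e * bs_a).

Lemma bst_originE g : bst_origin (lcoset _ g) = lcoset bs_b g.
Proof.
have [k hk] := repr_lcoset (expz bs_b n) g.
by apply/esym/lcosetP; exists (n * k)%R; rewrite hk expzM.
Qed.

Lemma bst_terminusE g : bst_terminus (lcoset _ g) = lcoset bs_b (g * bs_a).
Proof.
have [k hk] := repr_lcoset (expz bs_b n) g.
apply/esym/lcosetP; exists (m * k)%R.
rewrite hk -{1}BS_relation expz_conj expzM.
by rewrite !mulgA mulgVK.
Qed.

Definition bass_serre_tree : graph := Graph bst_origin bst_terminus.

Definition bst_fixes (g : BS m n) (T : subgraph bass_serre_tree) : Prop :=
  (forall v : bst_vert, sverts T v -> lcoset_act g v = v) /\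
  (forall e : bst_edge, sedges T e -> lcoset_act g e = e).

End BassSerre.

(* Main.v *)
Require Import Defs.
From mathcomp Require Import all_boot all_order all_algebra.
From mathcomp Require Import zify ring boolp.

Set Implicit Arguments.
Unset Strict Implicit.
Unset Printing Implicit Defensive.

Import GRing.Theory Num.Theory.

(** Fixed-point sets.  If [b^j] commutes past a word [w] up to changing the
    exponent, that is [b^j w = w b^j'], then [b^j] fixes the vertex
    [w<b>].  Each step [b^r a] from a vertex turns an exponent [n q] into [m q],
    each step [b^r a^-1] turns [m q] into [n q]; so a power of [b] fixes an
    infinite path as soon as the successive exponents keep being divisible.
    If [m] and [n] both have absolute value at least 2, the path
    [b a b a^-1 b a b a^-1 ...] works for [b^n], which commutes with [b] and
    with [a b a^-1]: the exponents alternate between [n] and [m].  If [n = 1] or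
    [n = -1] the path [a a a ...] works, as nothing has to be divided, and
    [a^-1 a^-1 ...] works likewise when [m = 1] or [m = -1]
    (exists_fixed_itinerary).

    What remains is to show that these paths go to infinity and that the
    fixing power of [b] is not trivial.  For the first, the group acts on the
    reduced finite paths issued from the base vertex, which is the action on the
    vertices of the tree written in normal forms (letter_act_eq).  The length
    of the normal form of a vertex changes by at most one along an edge
    (depth_edge), and it equals [k] at the [k]-th vertex of a reduced path
    (tree_act_route).  A sequence of edges along which such a height grows by
    one at each step is an unbounded subtree (ray_is_subtree, ray_unbounded).
    For the second, [b] acts on the rationals as the translation by 1 when [a]
    acts as the multiplication by [n / m] (bs_b_expz_neq1). *)

(** * Actions of a presented group *)

(** The set [P] is there because the action used on the tree satisfies the
    relations on normal forms only. *)
Lemma foldr_word_eq (X : choiceType) (R : word X -> word X -> Prop) (A : Type)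
    (f : X * bool -> A -> A) (P : A -> Prop) :
  (forall x a, P a -> P (f x a)) ->
  (forall x e a, P a -> f (x, e) (f (x, ~~ e) a) = a) ->
  (forall u v a, R u v -> P a -> foldr f a u = foldr f a v) ->
  forall u v, word_eq R u v -> forall a, P a -> foldr f a u = foldr f a v.
Proof.
move=> fP fK fR.
have foldP u a : P a -> P (foldr f a u) by move=> Pa; elim: u => //= x u; apply: fP.
move=> u v; elim=> {u v} [//|u v _ IH a Pa|u v w _ IHuv _ IHvw a Pa||x e a Pa|].
- by rewrite IH.
- by rewrite IHuv ?IHvw.
- by move=> u u' v v' _ IHu _ IHv a Pa; rewrite !foldr_cat IHv // IHu //; apply: foldP.
- exact: fK.
- by move=> u v Ruv a Pa; apply: fR.
Qed.

(** * Rays in a graph with a height function *)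

Lemma dsrc_drev (X : graph) (s : dart X) : dsrc (drev s) = dtgt s.
Proof. by case: s => e []. Qed.

Lemma dtgt_drev (X : graph) (s : dart X) : dtgt (drev s) = dsrc s.
Proof. by case: s => e []. Qed.

Lemma drevK (X : graph) : involutive (@drev X).
Proof. by case=> e c; rewrite /drev /= negbK. Qed.

Lemma walk_cat (X : graph) (v1 v2 v3 : vert X) (p q : seq (dart X)) :
  walk v1 p v2 -> walk v2 q v3 -> walk v1 (p ++ q) v3.
Proof.
elim: p v1 => [v1 /eqP -> //|s p IH v1 /= /andP[-> /IH]]; exact.
Qed.

Section Ray.
Variables (X : graph) (u : nat -> vert X) (d : nat -> dart X) (h : vert X -> nat).
Hypothesis d_src : forall k, dsrc (d k) = u k.
Hypothesis d_tgt : forall k, dtgt (d k) = u k.+1.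
Hypothesis hu : forall k, h (u k) = k.
Hypothesis h_lip : forall s : dart X, h (dtgt s) <= (h (dsrc s)).+1.

Lemma ray_endpoints k :
  (origin (d k).1 = u k /\ terminus (d k).1 = u k.+1) \/
  (origin (d k).1 = u k.+1 /\ terminus (d k).1 = u k).
Proof.
move: (d_src k) (d_tgt k); rewrite /dsrc /dtgt; case: (d k) => e [] /= -> ->; by [right|left].
Qed.

Lemma ray_origin e :
  (exists k, e = (d k).1) -> exists k, origin e = u k.
Proof. by case=> k ->; case: (ray_endpoints k) => -[-> _]; eexists. Qed.

Lemma ray_terminus e :
  (exists k, e = (d k).1) -> exists k, terminus e = u k.
Proof. by case=> k ->; case: (ray_endpoints k) => -[_ ->]; eexists. Qed.

Definition ray : subgraph X :=
  @Subgraph X (fun v => exists k, v = u k) (fun e => exists k, e = (d k).1)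
    ray_origin ray_terminus.

Lemma ray_dart s : sedges ray s.1 -> exists k, s = d k \/ s = drev (d k).
Proof.
case=> k; case: s => e c /= ->; exists k; rewrite /drev.
case: (d k) c => e2 [] [] /=; by [left|right].
Qed.

Lemma u_inj : injective u.
Proof. by move=> i j /(congr1 h); rewrite !hu. Qed.

Lemma walk_ray i j : exists2 p, walk (u i) p (u j) & walk_in ray p.
Proof.
have up : exists2 p, walk (u 0) p (u j) & walk_in ray p.
  elim: j => [|j [p wp pT]]; first by exists [::]; rewrite /= ?eqxx.
  exists (p ++ [:: d j]).
    by apply: (walk_cat wp); rewrite /= d_src d_tgt !eqxx.
  by move=> s; rewrite mem_cat => /orP[/pT //|]; rewrite inE => /eqP ->; exists j.
have down : exists2 p, walk (u i) p (u 0) & walk_in ray p.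
  elim: i => [|i [p wp pT]]; first by exists [::]; rewrite /= ?eqxx.
  exists (drev (d i) :: p).
    by rewrite /= dsrc_drev dtgt_drev d_src d_tgt eqxx.
  by move=> s; rewrite inE => /orP[/eqP ->|/pT //]; exists i.
case: up down => p wp pT [q wq qT]; exists (q ++ p); first exact: walk_cat wq wp.
by move=> s; rewrite mem_cat => /orP[/qT|/pT].
Qed.

(** A walk in a ray that does not backtrack never turns: at each vertex, an edge
    of the ray other than the one just used can only lead on in the same
    direction. *)
Lemma ray_climb k p v : walk (u k.+1) p v -> walk_in ray p ->
  no_backtrack (d k :: p) -> k < h v.
Proof.
elim: p k => [|s p IH] k; first by move=> /eqP <- _ _; rewrite hu.
move=> /= /andP[/eqP ss wp] pT /andP[ns bt].
have sT : walk_in ray p by move=> t tp; apply: pT; rewrite inE tp orbT.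
case: (ray_dart (pT s (mem_head _ _))) => j [sE|sE]; subst s.
  move: ss wp bt; rewrite d_src d_tgt => /u_inj -> wp bt.
  exact: ltnW (IH _ wp sT bt).
by move: ss ns; rewrite dsrc_drev d_tgt => /u_inj [->]; rewrite eqxx.
Qed.

Lemma ray_descend k p v : walk (u k) p v -> walk_in ray p ->
  no_backtrack (drev (d k) :: p) -> h v <= k.
Proof.
elim: p k => [|s p IH] k; first by move=> /eqP <- _ _; rewrite hu.
move=> /= /andP[/eqP ss wp] pT /andP[ns bt].
have sT : walk_in ray p by move=> t tp; apply: pT; rewrite inE tp orbT.
case: (ray_dart (pT s (mem_head _ _))) => j [sE|sE]; subst s.
  by move: ss ns; rewrite d_src => /u_inj ->; rewrite drevK eqxx.
move: ss wp bt; rewrite dsrc_drev dtgt_drev d_src d_tgt => /u_inj <- wp bt.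
exact: leqW (IH _ wp sT bt).
Qed.

(** By [ray_climb] and [ray_descend] a walk in the ray without backtracking ends
    strictly above or strictly below its origin, hence is not closed. *)
Lemma ray_is_subtree : is_subtree ray.
Proof.
split; first by exists (u 0), 0.
  by move=> _ _ [i ->] [j ->]; apply: walk_ray.
case=> [[]//|s p] [_ [v /= /andP[/eqP ss wp]] bt _] pT.
have sT : walk_in ray p by move=> t tp; apply: pT; rewrite inE tp orbT.
case: (ray_dart (pT s (mem_head _ _))) => j [sE|sE]; subst s v.
  by move: wp; rewrite d_src d_tgt => /ray_climb/(_ sT bt); rewrite hu ltnn.
by move: wp; rewrite dsrc_drev dtgt_drev d_src d_tgt => /ray_descend/(_ sT bt); rewrite hu ltnn.
Qed.

Lemma walk_height v p w : walk v p w -> h w <= h v + size p.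
Proof.
elim: p v => [v /eqP ->|s p IH v /= /andP[/eqP <- /IH]]; first by rewrite addn0.
by move=> hw; rewrite addnS -addSn (leq_trans hw) // leq_add2r h_lip.
Qed.

(** The height bounds distances in the whole graph from below, so no shortcut
    outside the ray can bring its vertices together. *)
Lemma ray_unbounded : ~ bounded_verts (sverts ray).
Proof.
case=> N bN; pose P k := `[< exists2 p, walk (u 0) p (u N.+1) & size p = k >].
have exP : exists k, P k.
  by have [p wp _] := walk_ray 0 N.+1; exists (size p); apply/asboolP; exists p.
case: (ex_minnP exP) => k /asboolP[p wp pk] kmin.
have : k <= N.
  apply: (bN (u 0) (u N.+1)); [by exists 0|by exists N.+1|split; first by exists p].
  by move=> q wq; apply: kmin; apply/asboolP; exists q.
by have := walk_height wp; rewrite !hu pk; lia.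
Qed.

End Ray.

Section BaumslagSolitar.
Variables m n : int.
Hypotheses (m_neq0 : m <> 0%R) (n_neq0 : n <> 0%R).
Local Open Scope ring_scope.

(** * Powers of b are not trivial *)

(** The affine representation of the group on the rationals, the flag telling
    whether the letter is inverted. *)
Definition affine_letter (x : bool * bool) (y : rat) : rat :=
  match x with
  | (true, e) => if e then y - 1 else y + 1
  | (false, e) => if e then y * m%:~R / n%:~R else y * n%:~R / m%:~R
  end.

Lemma affine_bz k y : foldr affine_letter y (word_bz k) = y + k%:~R.
Proof.
have nN j z : foldr affine_letter z (nseq j (gen_b, true)) = z - j%:R.
  by elim: j => [|j /= ->]; rewrite ?subr0 // -natr1; ring.
have nP j z : foldr affine_letter z (nseq j (gen_b, false)) = z + j%:R.
  by elim: j => [|j /= ->]; rewrite ?addr0 // -natr1; ring.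
by case: k => k; rewrite /word_bz ?nN ?nP.
Qed.

Lemma bs_b_expz_neq1 k : k <> 0 -> expz (bs_b m n) k <> 1%g.
Proof.
have n0 : n%:~R != 0 :> rat by rewrite intr_eq0; exact/eqP.
have m0 : m%:~R != 0 :> rat by rewrite intr_eq0; exact/eqP.
move=> k0; rewrite -pword_bz => /pwordP bk.
have := @foldr_word_eq _ _ rat affine_letter (fun=> True) _ _ _ _ _ bk 0 I.
rewrite affine_bz /= add0r => kE.
apply: k0; apply/eqP; rewrite -(intr_eq0 rat); apply/eqP/kE => //.
  by move=> [] [] y _ /=; first [by ring | by field; rewrite ?n0 ?m0].
move=> _ _ y [-> ->] _; rewrite affine_bz !foldr_cat affine_bz /=.
by field; rewrite n0 m0.
Qed.

(** * The action on normal forms *)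

(** A pair [(r, e)] stands for the step [b^r a] if [e] is false and [b^r a^-1]
    if [e] is true.  With [N = modulus e] and [M = modulus (~~ e)], such a step
    carries [b^N] to [b^M], so [r] matters only modulo [N]. *)
Definition modulus (e : bool) : int := if e then m else n.

(** Left multiplication by [b^k] of the coset represented by a path: the
    remainder of [r + k] stays in place, and the quotient is pushed through the
    step as a power of [b]; what reaches the end is absorbed by [<b>]. *)
Fixpoint shift (k : int) (l : seq (int * bool)) : seq (int * bool) :=
  if l is x :: l' then
    (((x.1 + k) %% modulus x.2)%Z, x.2)
      :: shift (((x.1 + k) %/ modulus x.2)%Z * modulus (~~ x.2)) l'
  else [::].

(** Left multiplication by [a] or [a^-1]. *)
Definition turn (e : bool) (l : seq (int * bool)) : seq (int * bool) :=
  if ohead l == Some (0, ~~ e) then behead l else (0, e) :: l.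

(** Normal forms of cosets of [<b>]: digits are remainders, and no two successive
    steps cancel. *)
Fixpoint reduced (l : seq (int * bool)) : bool :=
  if l is x :: l' then
    [&& (x.1 %% modulus x.2)%Z == x.1, ohead l' != Some (0, ~~ x.2) & reduced l']
  else true.

Lemma modulus_neq0 e : modulus e != 0.
Proof. by case: e; apply/eqP. Qed.

Lemma shiftD j k l : shift j (shift k l) = shift (j + k) l.
Proof.
elim: l j k => //= -[r e] l IH j k /=; rewrite IH modzDml -mulrDl.
have -> : r + k + j = r + (j + k) by ring.
congr (_ :: shift (_ * _) l).
have -> : r + (j + k) = ((r + k) %/ modulus e)%Z * modulus e + (((r + k) %% modulus e)%Z + j).
  by rewrite (addrA (_ * _)) -divz_eq; ring.
by rewrite divzMDl ?modulus_neq0 // addrC.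
Qed.

Lemma divz_digit r e : (r %% modulus e)%Z = r -> (r %/ modulus e)%Z = 0.
Proof.
move=> rE; apply: (mulIf (modulus_neq0 e)); apply: (addIr r).
by rewrite mul0r add0r -[X in _ + X = _]rE -divz_eq.
Qed.

Lemma shift0 l : reduced l -> shift 0 l = l.
Proof.
elim: l => //= -[r e] l IH /and3P[/= /eqP rE _ /IH lE].
by rewrite addr0 rE divz_digit // mul0r lE.
Qed.

(** A power of [b^(modulus e)] does not change the digit of a leading step of
    direction [e], so it neither creates nor destroys a cancellation. *)
Lemma shift_head e q l : reduced l ->
  (ohead (shift (q * modulus e) l) == Some (0, e)) = (ohead l == Some (0, e)).
Proof.
case: l => //= -[r e'] l /and3P[/= /eqP rE _ _].
have [eE|ne] := eqVneq e' e; last first.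
  by apply/eqP/eqP => -[_ /eqP]; rewrite (negbTE ne).
by subst e'; rewrite addrC modzMDl rE.
Qed.

Lemma reduced_shift k l : reduced l -> reduced (shift k l).
Proof.
elim: l k => //= -[r e] l IH k /and3P[/= _ hl rl].
by rewrite modz_mod eqxx IH // shift_head // hl.
Qed.

Lemma reduced_turn e l : reduced l -> reduced (turn e l).
Proof.
rewrite /turn; case: ifP => [_|/negbT hl rl] /=; last by rewrite mod0z eqxx hl.
by case: l => //= x l /and3P[].
Qed.

Lemma turnK e l : reduced l -> turn e (turn (~~ e) l) = l.
Proof.
move=> rl; rewrite {2}/turn negbK; case: ifP => [|_]; last by rewrite /turn /= eqxx.
case: l rl => //= x l /and3P[_ hl _] /eqP[xE]; subst x.
by rewrite /turn (negbTE hl).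
Qed.

(** The defining relation of the group, for powers [q] of both sides and for
    both orientations. *)
Lemma turn_shift_turn q e l : reduced l ->
  turn e (shift (q * modulus (~~ e)) (turn (~~ e) l)) = shift (q * modulus e) l.
Proof.
move=> rl; rewrite {2}/turn negbK; case: ifP => [|_].
  case: l rl => //= x l /and3P[_ hl rl] /eqP[xE]; subst x.
  rewrite /= add0r modzMl mulzK ?modulus_neq0 // /turn shift_head //.
  by rewrite (negbTE hl).
by rewrite /turn /= add0r modzMl mulzK ?modulus_neq0 // eqxx negbK.
Qed.

Definition letter_act (x : bool * bool) (l : seq (int * bool)) :=
  match x with
  | (true, e) => shift (if e then -1 else 1) l
  | (false, e) => turn e l
  end.

Lemma letter_act_bz k l : reduced l -> foldr letter_act l (word_bz k) = shift k l.
Proof.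
move=> rl.
have nN j : foldr letter_act l (nseq j (gen_b, true)) = shift (- j%:Z) l.
  elim: j => [|j /= ->]; first by rewrite oppr0 shift0.
  by rewrite shiftD; congr shift; lia.
have nP j : foldr letter_act l (nseq j (gen_b, false)) = shift j l.
  elim: j => [|j /= ->]; first by rewrite shift0.
  by rewrite shiftD; congr shift; lia.
by case: k => k; rewrite /word_bz ?nN ?nP.
Qed.

Lemma letter_act_reduced x l : reduced l -> reduced (letter_act x l).
Proof. by case: x => [] [] e; [apply: reduced_shift|apply: reduced_turn]. Qed.

Lemma letter_act_eq u v : word_eq (BS_rel m n) u v ->
  forall l, reduced l -> foldr letter_act l u = foldr letter_act l v.
Proof.
apply: foldr_word_eq; first exact: letter_act_reduced.
  move=> [] e l rl /=; last exact: turnK.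
  by rewrite shiftD -[RHS]shift0 //; case: e.
move=> _ _ l [-> ->] rl; rewrite letter_act_bz // !foldr_cat /=.
rewrite letter_act_bz ?reduced_turn //.
by have := turn_shift_turn 1 false rl; rewrite !mul1r.
Qed.

Definition tree_act (g : BS m n) (l : seq (int * bool)) := foldr letter_act l (repr g).

Lemma tree_act_pword u l : reduced l ->
  tree_act (pword (BS_rel m n) u) l = foldr letter_act l u.
Proof. by move=> rl; apply: letter_act_eq => //; apply: repr_pword. Qed.

Lemma tree_act_reduced g l : reduced l -> reduced (tree_act g l).
Proof. by move=> rl; rewrite /tree_act; elim: (repr g) => //= x u; apply: letter_act_reduced. Qed.

Lemma tree_actM g h l : reduced l -> tree_act (g * h)%g l = tree_act g (tree_act h l).
Proof.
by move=> rl; rewrite [(g * h)%g]/(pword _ _) tree_act_pword // foldr_cat.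
Qed.

Lemma tree_act_expz k l : reduced l -> tree_act (expz (bs_b m n) k) l = shift k l.
Proof. by move=> rl; rewrite -pword_bz tree_act_pword // letter_act_bz. Qed.

Definition steer (e : bool) : BS m n := if e then (bs_a m n)^-1%g else bs_a m n.

Lemma tree_act_steer e l : reduced l -> tree_act (steer e) l = turn e l.
Proof.
move=> rl; rewrite /steer; case: e; last by rewrite tree_act_pword.
have -> : ((bs_a m n)^-1)%g = pword (BS_rel m n) word_aV by exact: pwordV.
by rewrite tree_act_pword.
Qed.

(** * Distance to the base vertex *)

(** The normal form of [g<b>] is the image under [g] of the empty path. *)
Definition depth (v : bst_vert m n) : nat := size (tree_act (repr v) [::]).

Lemma depth_lcoset g : depth (lcoset _ g) = size (tree_act g [::]).
Proof.
rewrite /depth; have [k ->] := repr_lcoset (bs_b m n) g.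
by rewrite tree_actM // tree_act_expz.
Qed.

(** The parent of a vertex is obtained by removing the last step. The action
    works from the front of a path, which is why it preserves adjacency. *)
Definition extends (l l' : seq (int * bool)) := exists x, l' = rcons l x.

Lemma letter_act_adjacent x l l' : extends l l' \/ extends l' l ->
  extends (letter_act x l) (letter_act x l') \/
  extends (letter_act x l') (letter_act x l).
Proof.
wlog [y ->] : l l' / extends l l'.
  move=> W [ll'|l'l]; first by apply: W => //; left.
  by case: (W l' l l'l (or_introl l'l)); [right|left].
move=> _; case: x => [] [] e; last first.
  case: l => [|z l] /=; last first.
    by left; exists y; rewrite /turn /=; case: ifP.
  (* The only case where parent and child are exchanged: the step from the base
     vertex is cancelled. *)
  rewrite {1 4}/turn /turn /=; case: ifP => _; [right|left].
    by exists (0, e).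
  by exists y.
left; rewrite /letter_act; move: (if e then -1 else 1) => k {e}.
elim: l k => [|z l IH] k /=; first by eexists.
by have [w ->] := IH (((z.1 + k) %/ modulus z.2)%Z * modulus (~~ z.2)); exists w.
Qed.

Lemma tree_act_adjacent g l l' : extends l l' \/ extends l' l ->
  extends (tree_act g l) (tree_act g l') \/ extends (tree_act g l') (tree_act g l).
Proof.
move=> ll'; rewrite /tree_act; elim: (repr g) => //= x u.
exact: letter_act_adjacent.
Qed.

(** An edge is the translate of the edge from the base vertex to [a<b>]. *)
Lemma depth_edge (s : dart (bass_serre_tree m n)) :
  (depth (dtgt s) <= (depth (dsrc s)).+1)%N.
Proof.
suff [le1 le2] : (depth (bst_terminus s.1) <= (depth (bst_origin s.1)).+1)%N /\
    (depth (bst_origin s.1) <= (depth (bst_terminus s.1)).+1)%N.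
  by rewrite /dtgt /dsrc; case: s.2.
rewrite /bst_terminus /bst_origin !depth_lcoset tree_actM //.
have -> : tree_act (bs_a m n) [::] = [:: (0, false)] by rewrite (tree_act_steer false).
have [] := @tree_act_adjacent (repr s.1) [::] [:: (0, false)].
- by left; exists (0, false).
- by case=> x ->; rewrite size_rcons; split=> //; apply: leqW.
- by case=> x ->; rewrite size_rcons; split=> //; apply: leqW.
Qed.

(** * Reduced paths fixed by a power of b *)

Definition route (l : seq (int * bool)) : BS m n :=
  foldr (fun x g => (expz (bs_b m n) x.1 * steer x.2 * g)%g) 1%g l.

Lemma route_rcons l x :
  route (rcons l x) = (route l * (expz (bs_b m n) x.1 * steer x.2))%g.
Proof. by elim: l => [|y l /= ->]; rewrite /= ?mulg1 ?mul1g // !mulgA. Qed.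

Lemma tree_act_route l : reduced l -> tree_act (route l) [::] = l.
Proof.
elim: l => [_|[r e] l IH /= /and3P[/= /eqP rE hl rl]].
  by rewrite [LHS](@tree_act_pword [::] [::]).
rewrite !tree_actM ?tree_act_reduced // IH // tree_act_steer // tree_act_expz ?reduced_turn //.
by rewrite /turn (negbTE hl) /= add0r rE divz_digit // mul0r shift0.
Qed.


Lemma expz_steer q e :
  (expz (bs_b m n) (q * modulus e) * steer e
   = steer e * expz (bs_b m n) (q * modulus (~~ e)))%g.
Proof.
have nE : (expz (bs_b m n) (q * n) * bs_a m n = bs_a m n * expz (bs_b m n) (q * m))%g.
  by rewrite ![q * _]mulrC -!expzM -(BS_relation m n) expz_conj mulgVK.
case: e => /=; last exact: nE.
by apply: (mulgI (bs_a m n)); rewrite !mulgA -nE mulgK mulgV mul1g.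
Qed.

(** Here [j k] is the exponent for which [b^(j 0)] acts at the [k]-th vertex of
    the infinite path [c] as [b^(j k)] does at the base vertex. *)
Lemma exists_fixed_itinerary : exists (c : nat -> int * bool) (j q : nat -> int),
  [/\ forall k, reduced (mkseq c k), j 0%N <> 0 &
    forall k, j k = q k * modulus (c k).2 /\ j k.+1 = q k * modulus (~~ (c k).2)].
Proof.
have red (c : nat -> int * bool) :
    (forall k, ((c k).1 %% modulus (c k).2)%Z = (c k).1) ->
    (forall k, c k.+1 != (0, ~~ (c k).2)) -> forall k, reduced (mkseq c k).
  move=> cr cn k; rewrite /mkseq; elim: k 0%N => //= k IH i.
  by rewrite cr eqxx IH andbT; case: k {IH} => //= k; apply: cn.
have [[e /orP eE]|big] := pselect (exists e, (modulus e == 1) || (modulus e == -1)).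
  (* A modulus 1 or -1 is its own inverse: the quotient of an exponent by it is
     their product. *)
  pose f := modulus e * modulus (~~ e).
  exists (fun=> (0, e)), (fun k => f ^+ k), (fun k => f ^+ k * modulus e).
  split=> [||k]; last by rewrite exprS /f /=; split; first case: eE => /eqP ->; ring.
    by apply: red => k /=; rewrite ?mod0z //; case: (e).
  by rewrite expr0.
exists (fun k => (1, odd k)), (fun k => modulus (odd k)), (fun=> 1).
split=> [||k]; last by rewrite !mul1r.
  apply: red => [k|k] /=; last by [].
  rewrite -modz_abs modz_small //=.
  have := modulus_neq0 (odd k).
  have := contra_not (fun H => ex_intro _ (odd k) H) big.
  lia.
exact/eqP/modulus_neq0.
Qed.

(** The exponents [j] follow the path [c]: [b^(j 0) w = w b^(j k)] for the [k]-th
    initial segment [w] of [c].  The edges are fixed because [j k] is divisible by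
    the modulus of the [k]-th step. *)
Lemma fixed_ray (c : nat -> int * bool) (j q : nat -> int) :
  (forall k, reduced (mkseq c k)) ->
  (forall k, j k = q k * modulus (c k).2 /\ j k.+1 = q k * modulus (~~ (c k).2)) ->
  exists T : subgraph (bass_serre_tree m n),
    [/\ is_subtree T, ~ bounded_verts (sverts T) &
      bst_fixes (expz (bs_b m n) (j 0%N)) T].
Proof.
move=> cr jE.
pose b := bs_b m n; pose w k := route (mkseq c k).
have wS k : w k.+1 = (w k * expz b (c k).1 * steer (c k).2)%g.
  by rewrite /w mkseqS route_rcons mulgA.
pose u k : vert (bass_serre_tree m n) := lcoset b (w k).
(* The edge [g<b^n>] goes from [g<b>] to [ga<b>], so a step along [a^-1]
   traverses backwards the edge of its endpoint. *)
pose d k : dart (bass_serre_tree m n) :=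
  (lcoset (expz b n) (if (c k).2 then w k.+1 else w k * expz b (c k).1)%g, (c k).2).
have comm k : (expz b (j 0%N) * w k = w k * expz b (j k))%g.
  elim: k => [|k IH]; first by rewrite /w /= mulg1 mul1g.
  have [jk jSk] := jE k.
  rewrite wS !mulgA IH -!mulgA; congr (_ * _)%g.
  by rewrite jk jSk -expz_steer !mulgA -!expzD addrC.
have d_src k : dsrc (d k) = u k.
  rewrite /d /u /dsrc /= wS; case: (c k) => r [] /=; rewrite /steer.
    rewrite bst_terminusE mulgVK; apply/esym/lcosetP; by exists r.
  rewrite bst_originE; apply/esym/lcosetP; by exists r.
have d_tgt k : dtgt (d k) = u k.+1.
  rewrite /d /u /dtgt /= wS; case: (c k) => r [] /=; rewrite /steer.
    by rewrite bst_originE.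
  by rewrite bst_terminusE.
pose h : vert (bass_serre_tree m n) -> nat := fun v => depth v.
have hu k : h (u k) = k.
  by rewrite /h /u depth_lcoset tree_act_route // size_mkseq.
have hl s : (h (dtgt s) <= (h (dsrc s)).+1)%N by exact: depth_edge.
exists (ray d_src d_tgt); split.
- exact: (ray_is_subtree _ _ hu).
- exact: (ray_unbounded hu hl).
split=> [_ [k ->]|_ [k ->]]; rewrite /= lcoset_actE.
  by rewrite comm; apply/esym/lcosetP; exists (j k).
apply/esym/lcosetP; have [jk jSk] := jE k; exists (q k); rewrite expzM.
case: (c k).2 jk jSk => /= jk jSk.
  by rewrite comm jSk mulrC.
by rewrite mulgA comm -!mulgA -!expzD mulrC -jk addrC.
Qed.

End BaumslagSolitar.

Theorem mainTheorem6 (m n : int) (hm : m <> 0%R) (hn : n <> 0%R) :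
  exists g : BS m n, g <> 1%g /\
    exists T : subgraph (bass_serre_tree m n),
      [/\ is_subtree T, ~ bounded_verts (sverts T) & bst_fixes g T].
Proof.
have [c [j [q [cr j0 jE]]]] := exists_fixed_itinerary hm hn.
exists (expz (bs_b m n) (j 0%N)); split; first exact: bs_b_expz_neq1.
exact: fixed_ray cr jE.
Qed.
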